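(* For all non-empty Noetherian spaces $X$ and $Y$, $\mathrm{sob}(X \times Y) = (\mathrm{sob}\, X \oplus \mathrm{sob}\, Y) - 1$. If $X$ or $Y$ is empty, then $\mathrm{sob}(X \times Y) = 0$.
   Context: A topological space is Noetherian if every open subset is compact (every open cover has a finite subcover; no separation is required). $X \times Y$ carries the product topology and is Noetherian when $X$ and $Y$ are. $\oplus$ is the natural (Hessenberg) sum of ordinals, and for a successor ordinal $\alpha$, $\alpha - 1$ is the ordinal whose successor is $\alpha$. For a well-founded poset $P$ and $x \in P$, $\mathrm{rk}_P(x) = \sup_{x' < x} (\mathrm{rk}_P(x')+1)$ and the ordinal rank of $P$ is $|P| = \sup_{x \in P} (\mathrm{rk}_P(x)+1)$, where $\sup\emptyset = 0$. A closed subset $C$ of $X$ is irreducible if it is non-empty and, whenever $C \subseteq F_1 \cup F_2$ with $F_1, F_2$ closed in $X$, we have $C \subseteq F_1$ or $C \subseteq F_2$. $\mathcal{S} X$ is the poset of irreducible closed subsets of $X$, ordered by inclusion (well-founded when $X$ is Noetherian). The sobrification rank of a Noetherian space $X$ is $\mathrm{sob}\, X = |\mathcal{S} X|$; it is a successor ordinal when $X$ is non-empty. *)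

(* Defs.v *)
From HB Require Import structures.
From mathcomp Require Import all_boot all_order.
From mathcomp Require Import finmap.
From mathcomp Require Import boolp classical_sets functions filter topology.

Set Implicit Arguments.
Unset Strict Implicit.
Unset Printing Implicit Defensive.

Import Order.TTheory.

Local Open Scope classical_set_scope.

Declare Scope ord_scope.
Delimit Scope ord_scope with Ord.

(* Ordinals are well-founded trees modulo mutual comparability: [Node f]      *)
(* stands for the least ordinal strictly above every [f i].                   *)
Inductive tree : Type := Node (I : Type) (f : I -> tree).

Definition arity (a : tree) : Type := let: Node T _ := a in T.
Definition child (a : tree) : arity a -> tree :=
  let: Node T f as a0 := a return arity a0 -> tree in f.

Fixpoint tle (a b : tree) {struct a} : Prop :=
  match a, b with
  | Node T f, Node U g => forall i : T, exists j : U, tle (f i) (g j)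
  end.
Definition tlt (a b : tree) : Prop := exists j : arity b, tle a (child j).
Definition teq (a b : tree) : Prop := tle a b /\ tle b a.

Lemma tleP a b : tle a b <-> forall i : arity a, tlt (child i) b.
Proof. by case: a; case: b. Qed.

Lemma tle_refl a : tle a a.
Proof. by elim: a => I f IH /= i; exists i. Qed.

Lemma tle_trans b a c : tle a b -> tle b c -> tle a c.
Proof.
elim: a b c => I f IH [J g] [K h] /= ab bc i.
by have [j fg] := ab i; have [k gh] := bc j; exists k; exact: IH fg gh.
Qed.

Lemma tlt_child a (i : arity a) : tlt (child i) a.
Proof. by exists i; exact: tle_refl. Qed.

Lemma tlt_le_trans b a c : tlt a b -> tle b c -> tlt a c.
Proof.
move=> [j ab] /tleP /(_ j)[k bc]; exists k; exact: tle_trans ab bc.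
Qed.

Lemma tle_lt_trans b a c : tle a b -> tlt b c -> tlt a c.
Proof. by move=> ab [k bc]; exists k; exact: tle_trans ab bc. Qed.

Lemma tltW a b : tlt a b -> tle a b.
Proof.
elim: a b => I f IH b [j /tleP ab]; apply/tleP => i.
by exists j; apply: IH; exact: ab.
Qed.

Lemma tlt_irr a : ~ tlt a a.
Proof.
elim: a => I f IH [j /tleP ab]; apply: (IH j); exact: ab.
Qed.

Lemma tle_total a b : tle a b \/ tlt b a.
Proof.
elim: a b => I f IH b.
have [[i bi]|h] := pselect (exists i, tle b (f i)); first by right; exists i.
left; apply/tleP => /= i; case: b => J g in h *.
have [[j fj]|h'] := pselect (exists j, tle (f i) (g j)); first by exists j.
exfalso; apply: h; exists i; apply/tleP => /= j.
by have [fg|//] := IH i (g j); exfalso; apply: h'; exists j.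
Qed.

Lemma teq_refl a : teq a a.
Proof. by split; exact: tle_refl. Qed.

Lemma teq_sym a b : teq a b -> teq b a.
Proof. by case. Qed.

Lemma teq_trans b a c : teq a b -> teq b c -> teq a c.
Proof. by move=> [ab ba] [bc cb]; split; apply: (@tle_trans b). Qed.

Record Ord : Type := MkOrd { ocls : tree -> Prop; oclsP : exists a, ocls = teq a }.
Bind Scope ord_scope with Ord.

Definition opi (a : tree) : Ord := MkOrd (ex_intro _ a erefl).
Definition orepr (x : Ord) : tree := projT1 (cid (oclsP x)).

Lemma opiP a b : opi a = opi b <-> teq a b.
Proof.
split=> [[E]|ab]; first by rewrite E; exact: teq_refl.
have E : teq a = teq b.
  apply/funext => c; apply/propext; split; apply: teq_trans => //.
  exact: teq_sym.
rewrite /opi; move: (ex_intro _ a _) (ex_intro _ b _); rewrite E => p q.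
by rewrite (Prop_irrelevance p q).
Qed.

Lemma oreprK : cancel orepr opi.
Proof.
move=> x; rewrite /orepr; case: cid => /= a; case: x => C CP /= E.
rewrite /opi; move: (ex_intro _ a _); rewrite -E => p.
by rewrite (Prop_irrelevance p CP).
Qed.

Lemma opiK a : teq (orepr (opi a)) a.
Proof. by apply/opiP; rewrite oreprK. Qed.

Definition ole (x y : Ord) : Prop := tle (orepr x) (orepr y).
Definition olt (x y : Ord) : Prop := tlt (orepr x) (orepr y).

Notation "x <= y" := (ole x y) : ord_scope.
Notation "x < y" := (olt x y) : ord_scope.

Definition ozero : Ord := opi (Node (fun i : False => match i with end)).

Definition osucc (x : Ord) : Ord := opi (Node (fun _ : unit => orepr x)).

Definition osup (I : Type) (x : I -> Ord) : Ord :=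
  opi (Node (fun p : {i : I & arity (orepr (x i))} => child (projT2 p))).

(* [opred x] is the ordinal whose successor is [x]; it is only meaningful when *)
(* [x] is a successor.                                                         *)
Definition opred (x : Ord) : Ord :=
  if pselect (exists y, x = osucc y) is left e then projT1 (cid e) else ozero.

(* Natural sum: a (+) b is the least ordinal strictly above all a' (+) b with *)
(* a' < a and all a (+) b' with b' < b; see [oadd_le].                        *)
Fixpoint tadd (a : tree) : tree -> tree :=
  match a with
  | Node T f =>
    fix tadd_a (b : tree) : tree :=
      match b with
      | Node U g => Node (fun k : T + U =>
          match k with
          | inl i => tadd (f i) b
          | inr j => tadd_a (g j)
          end)
      end
  end.

Definition oadd (x y : Ord) : Ord := opi (tadd (orepr x) (orepr y)).

Notation "x (+) y" := (oadd x y) (at level 50, left associativity) : ord_scope.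

Section OrdTheory.
Local Open Scope ord_scope.
Implicit Types x y z : Ord.

Lemma ole_opi a b : (opi a <= opi b) <-> tle a b.
Proof.
have [[? ?] [? ?]] := (opiK a, opiK b).
split=> h; [apply: (@tle_trans (orepr (opi a))) => //|apply: (@tle_trans a) => //].
  exact: tle_trans h _.
exact: tle_trans h _.
Qed.

Lemma olt_opi a b : (opi a < opi b) <-> tlt a b.
Proof.
have [[? ?] [? ?]] := (opiK a, opiK b).
split=> h; [apply: (@tle_lt_trans (orepr (opi a))) => //|apply: (@tle_lt_trans a) => //].
  exact: tlt_le_trans h _.
exact: tlt_le_trans h _.
Qed.

Lemma ole_refl x : x <= x.
Proof. exact: tle_refl. Qed.

Lemma ole_trans y x z : x <= y -> y <= z -> x <= z.
Proof. exact: tle_trans. Qed.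

Lemma ole_anti x y : x <= y -> y <= x -> x = y.
Proof. by move=> xy yx; rewrite -(oreprK x) -(oreprK y); apply/opiP. Qed.

Lemma olt_irr x : ~ (x < x).
Proof. exact: tlt_irr. Qed.

Lemma oltW x y : x < y -> x <= y.
Proof. exact: tltW. Qed.

Lemma olt_le_trans y x z : x < y -> y <= z -> x < z.
Proof. exact: tlt_le_trans. Qed.

Lemma ole_lt_trans y x z : x <= y -> y < z -> x < z.
Proof. exact: tle_lt_trans. Qed.

Lemma oltNge x y : x < y <-> ~ (y <= x).
Proof.
split=> [xy yx|nyx]; first exact: (@olt_irr x (olt_le_trans xy yx)).
by have [//|] := tle_total (orepr y) (orepr x).
Qed.

Lemma ole_ltP x y : x <= y <-> forall z, z < x -> z < y.
Proof.
split=> [xy z zx|h]; first exact: olt_le_trans xy.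
apply/tleP => i; rewrite -olt_opi oreprK; apply: h.
by rewrite -[x in _ < x]oreprK olt_opi; exact: tlt_child.
Qed.

Lemma olt_wf : well_founded olt.
Proof.
suff acc a : forall x, x < opi a -> Acc olt x.
  by move=> x; constructor=> y; rewrite -{1}(oreprK x); exact: acc.
elim: a => I f IH x; rewrite -{1}(oreprK x) olt_opi => -[/= i xi].
constructor=> y yx; apply: (IH i).
by apply: olt_le_trans yx _; rewrite -(oreprK x) ole_opi.
Qed.

Lemma ozero_le x : ozero <= x.
Proof. by rewrite -(oreprK x) /ozero ole_opi; apply/tleP => -[]. Qed.

Lemma osucc_le x y : osucc x <= y <-> x < y.
Proof.
rewrite -{1}(oreprK y) /osucc ole_opi tleP.
by split=> [/(_ tt)|xy []].
Qed.

Lemma olt_succ x y : x < osucc y <-> x <= y.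
Proof. by rewrite oltNge osucc_le oltNge; split=> [/contrapT|xy /(_ xy)]. Qed.

Lemma osuccK : cancel osucc opred.
Proof.
move=> x; rewrite /opred; case: pselect => [e|[]]; last by exists x.
case: cid => y /= xy.
by apply: ole_anti; apply/olt_succ; [rewrite xy|rewrite -xy]; apply/olt_succ/ole_refl.
Qed.

Lemma osup_le (I : Type) (x : I -> Ord) y : osup x <= y <-> forall i, x i <= y.
Proof.
rewrite -{1}(oreprK y) /osup ole_opi tleP.
split=> [h i|h [i k] /=]; first by apply/tleP => k; exact: (h (existT _ i k)).
by have /tleP := h i; exact.
Qed.

Lemma tadd_le a b c : tle (tadd a b) c <->
  (forall i : arity a, tlt (tadd (child i) b) c) /\
  (forall j : arity b, tlt (tadd a (child j)) c).
Proof.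
rewrite tleP; case: a => I f; case: b => J g /=; split=> [h|[h1 h2] [i|j]] //.
by split=> [i|j]; [exact: (h (inl i))|exact: (h (inr j))].
Qed.

Lemma tadd_homo a a' b b' : tle a a' -> tle b b' -> tle (tadd a b) (tadd a' b').
Proof.
elim: a a' b b' => I f IHa a'; elim=> J g IHb b' aa bb; apply/tadd_le; split=> /= k.
  have [i fi] : tlt (f k) a' by move/tleP: aa; apply.
  apply: (@tle_lt_trans (tadd (child i) b')); first exact: IHa.
  by have /tadd_le[+ _] := tle_refl (tadd a' b'); apply.
have [j gj] : tlt (g k) b' by move/tleP: bb; apply.
apply: (@tle_lt_trans (tadd a' (child j))); first exact: IHb.
by have /tadd_le[_] := tle_refl (tadd a' b'); apply.
Qed.

Lemma oadd_opi a b : opi a (+) opi b = opi (tadd a b).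
Proof.
have [[? ?] [? ?]] := (opiK a, opiK b).
by apply/opiP; split; apply: tadd_homo.
Qed.

Lemma oadd_le x y z : x (+) y <= z <->
  (forall x', x' < x -> x' (+) y < z) /\ (forall y', y' < y -> x (+) y' < z).
Proof.
rewrite -(oreprK x) -(oreprK y) -(oreprK z).
move: (orepr x) (orepr y) (orepr z) => a b c.
rewrite oadd_opi ole_opi tadd_le; split=> -[h1 h2]; split.
- move=> x'; rewrite -(oreprK x') oadd_opi !olt_opi => -[i xi].
  by apply: tle_lt_trans (h1 i); exact: tadd_homo xi (tle_refl _).
- move=> x'; rewrite -(oreprK x') oadd_opi !olt_opi => -[i xi].
  by apply: tle_lt_trans (h2 i); exact: tadd_homo (tle_refl _) xi.
- move=> i; have := h1 (opi (child i)).
  by rewrite oadd_opi !olt_opi; apply; exact: tlt_child.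
- move=> i; have := h2 (opi (child i)).
  by rewrite oadd_opi !olt_opi; apply; exact: tlt_child.
Qed.

End OrdTheory.

Section Rank.
Context {d : Order.disp_t} {P : porderType d}.
Context (wfP : well_founded (fun x y : P => (x < y)%O)).

Definition rk : P -> Ord :=
  Fix wfP (fun=> Ord) (fun x rk_x =>
    osup (fun x' : {x' : P | (x' < x)%O} => osucc (rk_x (sval x') (svalP x')))).

Lemma rkE x : rk x = osup (fun x' : {x' : P | (x' < x)%O} => osucc (rk (sval x'))).
Proof.
rewrite /rk Fix_eq // => {}x r s rs; congr osup.
by apply/funext => y; rewrite rs.
Qed.

Definition orank : Ord := osup (fun x : P => osucc (rk x)).

End Rank.

HB.mixin Record isNoetherian X & Topological X := {
  open_compact : forall U : set X, open U -> cover_compact U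
}.

#[short(type="noetherianType")]
HB.structure Definition Noetherian := {X of Topological X & isNoetherian X}.

Definition irreducible_closed (X : topologicalType) (C : set X) : Prop :=
  [/\ closed C, C !=set0 &
    forall F1 F2 : set X, closed F1 -> closed F2 ->
      C `<=` F1 `|` F2 -> C `<=` F1 \/ C `<=` F2].

(* Irreducible closed subsets, ordered as in [set X], i.e. by inclusion.      *)
Record irrClosed (X : topologicalType) := IrrClosed {
  irrset :> set X;
  irrsetP : `[< irreducible_closed irrset >]
}.

HB.instance Definition _ (X : topologicalType) :=
  [isSub for @irrset X].
HB.instance Definition _ (X : topologicalType) :=
  [Choice of irrClosed X by <:].
HB.instance Definition _ (X : topologicalType) :=
  [SubChoice_isSubPOrder of irrClosed X by <: with Order.Disp tt tt].

Lemma irrClosed_le (X : topologicalType) (C D : irrClosed X) :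
  (C <= D)%O <-> (C : set X) `<=` D.
Proof. by rewrite -[(C <= D)%O]/((C : set X) <= (D : set X))%O -subsetEset. Qed.

Lemma irrClosed_lt (X : topologicalType) (C D : irrClosed X) :
  (C < D)%O <-> (C : set X) `<` D.
Proof. by rewrite -[(C < D)%O]/((C : set X) < (D : set X))%O -properEset. Qed.

(* [compact_cover] is stated for pointed spaces only.                         *)
Lemma compact_cover_compact (X : topologicalType) (A : set X) :
  compact A -> cover_compact A.
Proof.
have [[x _]|A0] := pselect (A !=set0); last first.
  by move=> _ I D f _ _; exists fset0 => // y Ay; case: A0; exists y.
pose T := HB.pack_for ptopologicalType X (isPointed.Build X x).
by rewrite -[compact A]/(@compact T A) compact_cover.
Qed.

Lemma noetherian_dcc (X : noetherianType) (C : nat -> set X) :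
  (forall n, closed (C n)) -> ~ (forall n, C n.+1 `<` C n).
Proof.
move=> Ccl Cdec.
have Cmon m n : (m <= n)%N -> C n `<=` C m.
  elim: n => [|n IH]; first by rewrite leqn0 => /eqP ->.
  rewrite leq_eqVlt => /predU1P[-> //|/IH]; apply: subset_trans.
  exact: properW.
have /(_ nat setT (fun n => ~` C n)) [i _|//|D _ cD] := @open_compact X
    (\bigcup_n ~` C n) (bigcup_open (fun i _ => closed_openC (Ccl i))).
  exact: closed_openC.
have [N hN] : exists N, forall n, n \in D -> (n <= N)%N.
  by exists (\max_(n <- D) n) => n nD; exact: leq_bigmax_seq.
have [_ /existsNP[x /not_implyP[xN xN1]]] := Cdec N.
have /cD[n nD] : (\bigcup_n ~` C n) x by exists N.+1.
by apply; exact: Cmon (hN n nD) _ xN.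
Qed.

Lemma irrClosed_wf (X : noetherianType) :
  well_founded (fun C D : irrClosed X => (C < D)%O).
Proof.
move=> C0; apply: contrapT => nC0.
pose T := {C : irrClosed X | ~ Acc (fun C D : irrClosed X => (C < D)%O) C}.
have step (C : T) : {D : T | (sval D < sval C)%O}.
  apply: cid; apply: contrapT => h; apply: (svalP C); constructor=> D DC.
  by apply: contrapT => nD; apply: h; exists (exist _ D nD).
pose C n : T := iter n (fun C => sval (step C)) (exist _ C0 nC0).
apply: (@noetherian_dcc X (fun n => irrset (sval (C n)))) => n.
  by have /asboolP[] := irrsetP (sval (C n)).
by apply/irrClosed_lt; exact: svalP (step (C n)).
Qed.

Lemma ultra_fmap (T U : Type) (f : T -> U) (F : set_system T) :
  UltraFilter F -> UltraFilter (f @ F).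
Proof.
move=> UF; split=> [|G PG FG]; first exact: fmap_proper_filter.
apply/seteqP; split=> A //; last exact: FG.
move=> GA; have [//|nA] := in_ultra_setVsetC (f @^-1` A) UF.
have GnA : G (~` A) by exact: FG.
have : G (A `&` ~` A) by exact: filterI.
by rewrite setICr => /filter_ex[].
Qed.

Lemma noetherian_ultra (X : noetherianType) (F : set_system X) :
  UltraFilter F -> F [set x | F --> x].
Proof.
move=> UF; apply: contrapT => nF.
pose V := [set V : set X | open V /\ ~ F V].
have Vop : forall W, V W -> open W by move=> W [].
have [//|D DV cD] := @open_compact X (cover V id) (bigcup_open Vop) _ V id Vop.
have FA : F (~` [set x | F --> x]).
  by have [] := in_ultra_setVsetC [set x | F --> x] UF.
have FD : F (\bigcap_(W in [set` D]) ~` W).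
  apply: filter_bigI => W WD; have /set_mem[_ nW] := DV W WD.
  by have [] := in_ultra_setVsetC W UF.
have /filter_ex[x [/= Fx xD]] :
    F (~` [set x | F --> x] `&` \bigcap_(W in [set` D]) ~` W) by exact: filterI.
apply: Fx => W; rewrite nbhsE => -[O [Oop Ox] OW].
apply: filterS OW _; apply: contrapT => nO.
have /cD[O' O'D xO'] : cover V id x by exists O.
exact: xD O'D xO'.
Qed.

Lemma prod_open_compact (X Y : noetherianType) (U : set (X * Y)) :
  open U -> cover_compact U.
Proof.
move=> _; apply: compact_cover_compact; rewrite compact_ultra => F UF FU.
have FX := @noetherian_ultra X (fst @ F) (ultra_fmap fst UF).
have FY := @noetherian_ultra Y (snd @ F) (ultra_fmap snd UF).
have : F (U `&` ((fst @^-1` [set x | fst @ F --> x]) `&`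
                 (snd @^-1` [set y | snd @ F --> y]))).
  by apply: filterI => //; apply: filterI; [exact: FX|exact: FY].
move=> /filter_ex[[x y] [Uxy [/= Fx Fy]]]; exists (x, y); split=> //.
move=> A [[A1 A2] [/= /Fx A1x /Fy A2y] AA].
have : F ((fst @^-1` A1) `&` (snd @^-1` A2)) by exact: filterI.
by apply: filterS => -[a b] [/= ? ?]; exact: AA.
Qed.

HB.instance Definition _ (X Y : noetherianType) :=
  isNoetherian.Build (X * Y)%type (@prod_open_compact X Y).

Definition sob (X : noetherianType) : Ord := orank (@irrClosed_wf X).

(* Main.v *)
Require Import Defs.
From mathcomp Require Import all_boot all_order.
From mathcomp Require Import boolp classical_sets topology.

(** Write [S X] for the poset of irreducible closed subsets of [X].  The
    theorem is a computation of ranks in [S (X * Y)], and rests on three facts.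

    Topology: [(C, D) |-> C `*` D] is an order isomorphism from [S X * S Y],
    ordered componentwise, onto [S (X * Y)] ([irreducible_closed_setX] and
    [irreducible_closed_rect]).

    Order theory: in a componentwise ordered product, the rank of [(p, q)] is
    the natural sum of the ranks of [p] and [q] ([rk_prod]).  Both sides satisfy
    the same recursion, since the elements below [(p, q)] are dominated by the
    [(p', q)] with [p' < p] and the [(p, q')] with [q' < q].

    Noetherian spaces: in a non-empty Noetherian space some irreducible closed
    subset has the largest rank ([sob_attained]), morally because there are
    only finitely many irreducible components.  If [C] and [D] are such subsets
    of [X] and [Y], of ranks [a] and [b], then [sob X] and [sob Y] are [a + 1]
    and [b + 1], and by monotonicity of the natural sum [C `*` D] has the largest
    rank in [S (X * Y)].  Thus [sob (X * Y)] is [(a (+) b) + 1], which is the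
    predecessor of [(a + 1) (+) (b + 1) = (a (+) b) + 2]. *)

Set Implicit Arguments.
Unset Strict Implicit.
Unset Printing Implicit Defensive.

Import Order.TTheory.

Local Open Scope classical_set_scope.

(** * Ordinals and the natural sum *)

Section Ordinals.
Local Open Scope ord_scope.
Implicit Types x y z : Ord.

Lemma ole_total x y : x <= y \/ y <= x.
Proof.
by have [|/tltW] := tle_total (orepr x) (orepr y); [left|right].
Qed.

Lemma ole_eqVlt x y : x <= y -> x = y \/ x < y.
Proof.
move=> xy; have [yx|nyx] := pselect (y <= x); first by left; exact: ole_anti.
by right; apply/oltNge.
Qed.

Lemma olt_osup (I : Type) (x : I -> Ord) y :
  y < osup x <-> exists i, y < x i.
Proof.
rewrite oltNge osup_le; split=> [/existsNP[i /oltNge yi]|[i /oltNge yi] h].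
  by exists i.
exact/yi/h.
Qed.

Lemma oadd_ltl x' x y : x' < x -> x' (+) y < x (+) y.
Proof. by have /oadd_le[+ _] := ole_refl (x (+) y); apply. Qed.

Lemma oadd_ltr x y' y : y' < y -> x (+) y' < x (+) y.
Proof. by have /oadd_le[_] := ole_refl (x (+) y); apply. Qed.

Lemma oadd_mono x x' y y' : x <= x' -> y <= y' -> x (+) y <= x' (+) y'.
Proof.
move=> /ole_eqVlt xx' yy'; apply: (@ole_trans (x (+) y')).
  have [->|/(oadd_ltr x)/oltW//] := ole_eqVlt yy'; exact: ole_refl.
by case: xx' => [->|/(oadd_ltl y')/oltW//]; exact: ole_refl.
Qed.

Lemma oaddC x y : x (+) y = y (+) x.
Proof.
suff H u v : u (+) v <= v (+) u by exact: ole_anti.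
elim/(well_founded_ind olt_wf): u v => u IHu; elim/(well_founded_ind olt_wf).
move=> v IHv; apply/oadd_le; split=> [u' uu|v' vv].
  by apply: ole_lt_trans (IHu _ uu v) _; exact: oadd_ltr.
by apply: ole_lt_trans (IHv _ vv) _; exact: oadd_ltl.
Qed.

Lemma oaddSl x y : osucc x (+) y = osucc (x (+) y).
Proof.
elim/(well_founded_ind olt_wf): y => y IH; apply: ole_anti; last first.
  by apply/osucc_le/oadd_ltl/olt_succ/ole_refl.
apply/oadd_le; split=> [x' /olt_succ xx|y' yy].
  by apply/olt_succ/oadd_mono => //; exact: ole_refl.
by rewrite (IH _ yy); apply/olt_succ/osucc_le/oadd_ltr.
Qed.

Lemma oaddSr x y : x (+) osucc y = osucc (x (+) y).
Proof. by rewrite oaddC oaddSl oaddC. Qed.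

End Ordinals.

(** * Ranks in well-founded posets *)

Section Rank.
Context {d : Order.disp_t} {P : porderType d}.
Context (wfP : well_founded (fun x y : P => (x < y)%O)).
Implicit Types p : P.

Lemma rk_le p x : (rk wfP p <= x)%Ord <->
  forall p', (p' < p)%O -> (rk wfP p' < x)%Ord.
Proof.
rewrite rkE osup_le; split=> [h p' pp|h [p' pp]].
  by apply/osucc_le; exact: (h (exist _ p' pp)).
exact/osucc_le/h.
Qed.

Lemma olt_rk p x : (x < rk wfP p)%Ord <->
  exists2 p', (p' < p)%O & (x <= rk wfP p')%Ord.
Proof.
rewrite rkE olt_osup; split=> [[[p' pp] /olt_succ xp]|[p' pp xp]].
  by exists p'.
by exists (exist _ p' pp); apply/olt_succ.
Qed.

Lemma rk_lt p' p : (p' < p)%O -> (rk wfP p' < rk wfP p)%Ord.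
Proof. by move=> pp; apply/olt_rk; exists p' => //; exact: ole_refl. Qed.

Lemma rk_mono p' p : (p' <= p)%O -> (rk wfP p' <= rk wfP p)%Ord.
Proof. by rewrite le_eqVlt => /predU1P[->|/rk_lt/oltW//]; exact: ole_refl. Qed.

Lemma orank_max p : (forall p', rk wfP p' <= rk wfP p)%Ord ->
  orank wfP = osucc (rk wfP p).
Proof.
move=> pmax; apply: ole_anti; last first.
  by apply/osucc_le/olt_osup; exists p; apply/olt_succ/ole_refl.
by apply/osup_le => p'; apply/osucc_le/olt_succ.
Qed.

Lemma orank_empty : (P -> False) -> orank wfP = ozero.
Proof.
move=> P0; apply: ole_anti (ozero_le _).
by apply/osup_le => p; have := P0 p.
Qed.

End Rank.

Section RankProduct.
Context {d1 d2 d : Order.disp_t}.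
Context {P : porderType d1} {Q : porderType d2} {R : porderType d}.
Context (wfP : well_founded (fun x y : P => (x < y)%O)).
Context (wfQ : well_founded (fun x y : Q => (x < y)%O)).
Context (wfR : well_founded (fun x y : R => (x < y)%O)).
Context (f : P -> Q -> R).
Context (f_le :
  forall p q p' q', (f p q <= f p' q')%O = (p <= p')%O && (q <= q')%O).
Context (f_surj : forall r, exists p q, r = f p q).

(** The hypotheses say that [f] is an order isomorphism from the componentwise
    ordered product of [P] and [Q] onto [R].  The rank of [f p q] is at most the
    natural sum because going down in [R] goes down in at least one
    component; it is at least the natural sum because any ordinal below the rank
    of [p] is bounded by the rank of some [p' < p], with [f p' q < f p q], and
    likewise for [q]. *)
Lemma rk_prod p q : rk wfR (f p q) = (rk wfP p (+) rk wfQ q)%Ord.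
Proof.
have f_lt p1 q1 p2 q2 : (f p1 q1 < f p2 q2)%O =
    [&& (p1 <= p2)%O, (q1 <= q2)%O & (p1 < p2)%O || (q1 < q2)%O].
  rewrite lt_leAnge !f_le !lt_leAnge -andbA.
  by case: (p1 <= p2)%O; case: (q1 <= q2)%O => //=; rewrite negb_and.
suff H r p0 q0 : r = f p0 q0 -> rk wfR r = (rk wfP p0 (+) rk wfQ q0)%Ord.
  exact: H.
elim/(well_founded_ind wfR): r p0 q0 => r IH {}p {}q rE.
rewrite rE in IH *; apply: ole_anti.
  apply/rk_le => r' rr; have [p' [q' r'E]] := f_surj r'.
  rewrite (IH _ rr _ _ r'E); move: rr; rewrite r'E f_lt.
  case/and3P => pp qq /orP[pp'|qq'].
    apply: (@ole_lt_trans (rk wfP p' (+) rk wfQ q)%Ord).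
      by apply: oadd_mono; [exact: ole_refl|exact: rk_mono].
    exact/oadd_ltl/rk_lt.
  apply: (@ole_lt_trans (rk wfP p (+) rk wfQ q')%Ord).
    by apply: oadd_mono; [exact: rk_mono|exact: ole_refl].
  exact/oadd_ltr/rk_lt.
apply/oadd_le; split=> [x /olt_rk[p' pp xp]|y /olt_rk[q' qq yq]].
  have lt_f : (f p' q < f p q)%O by rewrite f_lt (ltW pp) lexx pp.
  apply: ole_lt_trans (rk_lt wfR lt_f); rewrite (IH _ lt_f p' q erefl).
  by apply: oadd_mono => //; exact: ole_refl.
have lt_f : (f p q' < f p q)%O by rewrite f_lt (ltW qq) lexx qq orbT.
apply: ole_lt_trans (rk_lt wfR lt_f); rewrite (IH _ lt_f p q' erefl).
by apply: oadd_mono => //; exact: ole_refl.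
Qed.

End RankProduct.

(** * Irreducible closed subsets of a product *)

Lemma irreducible_closed_image {T U : topologicalType} (g : T -> U)
    (A : set T) : (forall B : set U, closed B -> closed (g @^-1` B)) ->
  irreducible_closed A -> irreducible_closed (closure (g @` A)).
Proof.
move=> gcl [_ [a Aa] Airr]; split; first exact: closed_closure.
  by exists (g a); apply: subset_closure; exists a.
move=> F1 F2 F1cl F2cl sub.
have clo F : closed F -> A `<=` g @^-1` F -> closure (g @` A) `<=` F.
  move=> Fcl AF; rewrite closureE; apply: smallest_sub => //.
  by move=> _ [b Ab <-]; exact: AF.
have /Airr[] : A `<=` g @^-1` F1 `|` g @^-1` F2.
- by move=> b Ab; apply: sub; apply: subset_closure; exists b.
- exact: gcl.
- exact: gcl.
- by move=> /(clo _ F1cl); left.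
- by move=> /(clo _ F2cl); right.
Qed.

Section IrreducibleProduct.
Context {X Y : topologicalType}.
Implicit Types (C : set X) (D : set Y) (E F : set (X * Y)).

Let closed_slicel F y : closed F -> closed [set x | F (x, y)].
Proof.
move=> Fcl; apply: (@preimage_closed _ _ (fun x : X => (x, y)) F) => // x _.
by apply: cvg_pair; [exact: cvg_id|exact: cvg_cst].
Qed.

Let closed_slicer F x : closed F -> closed [set y | F (x, y)].
Proof.
move=> Fcl; apply: (@preimage_closed _ _ (fun y : Y => (x, y)) F) => // y _.
by apply: cvg_pair; [exact: cvg_cst|exact: cvg_id].
Qed.

Let closed_fst C : closed C -> closed (fst @^-1` C : set (X * Y)).
Proof. by apply: preimage_closed => -[x y] _; exact: cvg_fst. Qed.

Let closed_snd D : closed D -> closed (snd @^-1` D : set (X * Y)).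
Proof. by apply: preimage_closed => -[x y] _; exact: cvg_snd. Qed.

(** Irreducibility is used twice: each slice [C `*` [set y]] lies in [F1] or in
    [F2], because [C] is irreducible; and the [y] for which a given
    [F] contains the slice form a closed set, so that irreducibility of [D] makes
    one of the two choices work for all [y] in [D]. *)
Lemma irreducible_closed_setX C D :
  irreducible_closed C -> irreducible_closed D -> irreducible_closed (C `*` D).
Proof.
move=> [Ccl [x Cx] Cirr] [Dcl [y Dy] Dirr]; split.
- rewrite (_ : C `*` D = fst @^-1` C `&` snd @^-1` D); last by [].
  by apply: closedI; [exact: closed_fst|exact: closed_snd].
- by exists (x, y).
move=> F1 F2 F1cl F2cl sub.
pose slices F : set Y := \bigcap_(x in C) [set y | F (x, y)].
have slices_cl F : closed F -> closed (slices F).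
  by move=> Fcl; apply: closed_bigI => *; exact: closed_slicer.
have slices_sub F : D `<=` slices F -> C `*` D `<=` F.
  by move=> DF [a b] [/= Ca Db]; exact: DF.
have /Dirr[] : D `<=` slices F1 `|` slices F2.
- move=> b Db.
  have /Cirr[] : C `<=` [set x | F1 (x, b)] `|` [set x | F2 (x, b)].
  + by move=> a Ca; exact: (sub (a, b)).
  + exact: closed_slicel.
  + exact: closed_slicel.
  + by move=> h; left.
  + by move=> h; right.
- exact: slices_cl.
- exact: slices_cl.
- by left; exact: slices_sub.
- by right; exact: slices_sub.
Qed.

(** If [(x, y)] is outside [E], a box [U `*` V] around it misses [E], so that [E]
    is covered by the closed sets [~` U `*` setT] and [setT `*` ~` V].  By
    irreducibility it lies in one of them, and hence [x] or [y] is not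
    adherent to the projection of [E]. *)
Lemma irreducible_closed_rect E : irreducible_closed E ->
  E = closure (fst @` E) `*` closure (snd @` E).
Proof.
move=> [Ecl _ Eirr]; apply/seteqP; split=> [[x y] Exy|[x y] [/= clx cly]].
  by split; apply: subset_closure; exists (x, y).
apply: contrapT => nExy.
have : nbhs (x, y) (~` E) by apply: open_nbhs_nbhs; split=> //; exact: closed_openC.
move=> [[A B] [/= Ax By] AB].
move: Ax By; rewrite !nbhsE => -[U [Uop Ux] UA] [V [Vop Vy] VB].
have /Eirr[] : E `<=` fst @^-1` (~` U) `|` snd @^-1` (~` V).
- move=> [a b] Eab; apply: contrapT => /not_orP[/contrapT Ua /contrapT Vb].
  by apply: (AB (a, b)) Eab; split; [exact: UA|exact: VB].
- by apply: closed_fst; exact: open_closedC.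
- by apply: closed_snd; exact: open_closedC.
- have [_ [[p Ep <-] Up]] := clx U (open_nbhs_nbhs (conj Uop Ux)).
  by move=> /(_ p Ep).
- have [_ [[p Ep <-] Vp]] := cly V (open_nbhs_nbhs (conj Vop Vy)).
  by move=> /(_ p Ep).
Qed.

Definition irrX (C : irrClosed X) (D : irrClosed Y) : irrClosed (X * Y)%type :=
  IrrClosed (asboolT (irreducible_closed_setX
    (asboolW (irrsetP C)) (asboolW (irrsetP D)))).

Lemma irrX_le (C : irrClosed X) (D : irrClosed Y)
    (C' : irrClosed X) (D' : irrClosed Y) :
  (irrX C D <= irrX C' D')%O = (C <= C')%O && (D <= D')%O.
Proof.
have [_ [x Cx] _] := asboolW (irrsetP C).
have [_ [y Dy] _] := asboolW (irrsetP D).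
apply/idP/andP => [/irrClosed_le sub|[/irrClosed_le CC /irrClosed_le DD]].
  split; apply/irrClosed_le; [move=> a Ca|move=> b Db].
    by have [] := sub (a, y) (conj Ca Dy).
  by have [] := sub (x, b) (conj Cx Db).
by apply/irrClosed_le => -[a b] [/= /CC ? /DD ?].
Qed.

Lemma irrX_surj (E : irrClosed (X * Y)%type) :
  exists (C : irrClosed X) (D : irrClosed Y), E = irrX C D.
Proof.
have Eirr := asboolW (irrsetP E).
exists (IrrClosed (asboolT (irreducible_closed_image closed_fst Eirr))).
exists (IrrClosed (asboolT (irreducible_closed_image closed_snd Eirr))).
by apply: val_inj => /=; exact: irreducible_closed_rect.
Qed.

End IrreducibleProduct.

(** * The sobrification rank of a Noetherian space *)

Lemma closed_wf (X : noetherianType) :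
  well_founded (fun F G : {F : set X | closed F} => sval F `<` sval G).
Proof.
move=> F0; apply: contrapT => nF0.
pose lt (F G : {F : set X | closed F}) := sval F `<` sval G.
have step (F : {F | ~ Acc lt F}) : {G : {F | ~ Acc lt F} | lt (sval G) (sval F)}.
  apply: cid; apply: contrapT => h; apply: (svalP F); constructor=> G GF.
  by apply: contrapT => nG; apply: h; exists (exist _ G nG).
pose F n := iter n (fun F => sval (step F)) (exist _ F0 nF0).
apply: (@noetherian_dcc X (fun n => sval (sval (F n)))) => n.
  exact: svalP (sval (F n)).
exact: svalP (step (F n)).
Qed.

(** This holds by induction over the closed sets inside a given one: a reducible
    closed set is the union of two smaller non-empty closed sets, and an irreducible
    subset of the union lies in one of the two parts, so the better of the two
    maxima for the parts is a maximum for the union. *)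
Lemma sob_attained (X : noetherianType) : [set: X] !=set0 ->
  exists C : irrClosed X, forall D : irrClosed X,
    (rk (@irrClosed_wf X) D <= rk (@irrClosed_wf X) C)%Ord.
Proof.
pose r := rk (@irrClosed_wf X).
suff H (F : {F : set X | closed F}) : sval F !=set0 ->
    exists C : irrClosed X, forall D : irrClosed X,
      (D : set X) `<=` sval F -> (r D <= r C)%Ord.
  move=> /(H (exist _ setT closedT))[C Cmax].
  by exists C => D; exact: Cmax.
elim/(well_founded_ind (@closed_wf X)): F => -[F Fcl] IH /= F0.
have [Firr|Fred] := pselect (irreducible_closed F).
  exists (IrrClosed (asboolT Firr)) => D DF.
  by apply: rk_mono; apply/irrClosed_le.
have [F1 [F2 [F1cl F2cl FU nF1 nF2]]] : exists F1 F2 : set X,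
    [/\ closed F1, closed F2, F `<=` F1 `|` F2, ~ F `<=` F1 & ~ F `<=` F2].
  apply: contrapT => h; apply: Fred; split=> // F1 F2 F1cl F2cl FU.
  apply: contrapT => /not_orP[nF1 nF2]; apply: h.
  by exists F1, F2.
have part G G' : closed G -> ~ F `<=` G -> ~ F `<=` G' -> F `<=` G `|` G' ->
    exists C : irrClosed X, forall D : irrClosed X,
      (D : set X) `<=` F `&` G -> (r D <= r C)%Ord.
  move=> Gcl nG nG' FGG'; apply: (IH (exist _ (F `&` G) (closedI Fcl Gcl))) => /=.
    by split=> [x []//|FG]; apply: nG => x /FG[].
  (* a point of [F] outside [G'] is in [G] *)
  have /existsNP[x /not_implyP[Fx nG'x]] := nG'.
  by exists x; split=> //; have [|/nG'x] := FGG' x Fx.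
have [C1 C1max] := part F1 F2 F1cl nF1 nF2 FU.
have [C2 C2max] : exists C : irrClosed X, forall D : irrClosed X,
    (D : set X) `<=` F `&` F2 -> (r D <= r C)%Ord.
  by apply: (part F2 F1) => //; rewrite setUC.
have bound (D : irrClosed X) : (D : set X) `<=` F ->
    (r D <= r C1)%Ord \/ (r D <= r C2)%Ord.
  have [_ _ Dirr] := asboolW (irrsetP D); move=> DF.
  have [|DF1|DF2] := Dirr F1 F2 F1cl F2cl; first exact: subset_trans FU.
    by left; apply: C1max => x Dx; split; [exact: DF|exact: DF1].
  by right; apply: C2max => x Dx; split; [exact: DF|exact: DF2].
have [C12|C21] := ole_total (r C1) (r C2).
  by exists C2 => D /bound[DC|//]; exact: ole_trans C12.
by exists C1 => D /bound[//|DC]; exact: ole_trans C21.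
Qed.

Lemma sob_empty (X : noetherianType) : (X -> False) -> sob X = ozero.
Proof.
move=> X0; apply: orank_empty => C.
by have [_ [x _] _] := asboolW (irrsetP C); exact: X0.
Qed.

Theorem proposition10p1 (X Y : noetherianType) :
  ([set: X] !=set0 -> [set: Y] !=set0 ->
     sob (X * Y)%type = opred (sob X (+) sob Y)%Ord) /\
  ([set: X] = set0 \/ [set: Y] = set0 -> sob (X * Y)%type = ozero).
Proof.
split=> [X0 Y0|XY0]; last first.
  apply: sob_empty => -[x y]; case: XY0 => E0.
    by have : [set: X] x by []; rewrite E0.
  by have : [set: Y] y by []; rewrite E0.
have [C Cmax] := sob_attained X0; have [D Dmax] := sob_attained Y0.
have rkX := rk_prod (@irrClosed_wf X) (@irrClosed_wf Y)
  (@irrClosed_wf (X * Y)%type) irrX_le irrX_surj.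
rewrite /sob (orank_max Cmax) (orank_max Dmax) oaddSl oaddSr osuccK -rkX.
apply: orank_max => E; have [C' [D' ->]] := irrX_surj E.
by rewrite !rkX; exact: oadd_mono.
Qed.
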